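(* Let $\mathcal{X}$ be a class of nonabelian CSA groups (hence $\mathcal{X}$ satisfies $B\mathcal{X}$). Let $\mathcal{Y}$ be the class of groups which have the form $G_1 \star_A G_2$, where $G_1, G_2$ are groups from $\mathcal{X}$ and $A$ is malnormal in $G_1$ and $G_2$. Then $\mathcal{Y}$ satisfies $B\mathcal{Y}$.
   Context: Let $\mathcal{X}$ be a class of groups. A group $G$ is residually $\mathcal{X}$ if for every nontrivial $g \in G$ there is a homomorphism $\phi: G \to H$ with $H \in \mathcal{X}$ and $\phi(g) \neq 1$. $G$ is fully residually $\mathcal{X}$ if for every finite set of nontrivial elements $g_1,\dots,g_n \in G$ there is a homomorphism $\phi: G \to H$ with $H \in \mathcal{X}$ and $\phi(g_i) \neq 1$ for all $i$. A group $G$ is commutative transitive (CT) if for all nontrivial $x,y,z \in G$, $[x,y]=1$ and $[y,z]=1$ imply $[x,z]=1$. A subgroup $M \le G$ is malnormal if $g^{-1}Mg \cap M \neq \{1\}$ implies $g \in M$. A group is CSA if all its maximal abelian subgroups are malnormal. A class $\mathcal{X}$ satisfies $B\mathcal{X}$ if every nonabelian group $G$ is fully residually $\mathcal{X}$ if and only if $G$ is residually $\mathcal{X}$ and CT. $G_1 \star_A G_2$ denotes the free product of $G_1$ and $G_2$ with amalgamated subgroup $A$ (identified with a subgroup of both factors). *)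

(* Defs.v *)
(* MathComp groups ([groupType], possibly infinite) with the classical sets of
   MathComp-Analysis. *)
From mathcomp Require Import all_boot.
From mathcomp Require Import boolp classical_sets.

Set Implicit Arguments.
Unset Strict Implicit.
Unset Printing Implicit Defensive.

Local Open Scope classical_set_scope.
Local Open Scope group_scope.

(* A class of groups is a predicate on [groupType]; it need not be closed under
   isomorphism. *)
Definition group_class := groupType -> Prop.

Definition abelian_group (G : groupType) : Prop :=
  forall x y : G, commute x y.

Definition subgroup (G : groupType) (M : set G) : Prop :=
  group_closed (mem M).

Definition abelian_subgroup (G : groupType) (M : set G) : Prop :=
  subgroup M /\ forall x y, M x -> M y -> commute x y.

Definition maximal_abelian (G : groupType) (M : set G) : Prop :=
  abelian_subgroup M /\
  forall N : set G, abelian_subgroup N -> M `<=` N -> N = M.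

Definition malnormal (G : groupType) (M : set G) : Prop :=
  subgroup M /\
  forall g : G, [set x ^ g | x in M] `&` M <> [set 1] -> M g.

Definition CSA (G : groupType) : Prop :=
  forall M : set G, maximal_abelian M -> malnormal M.

Definition commutative_transitive (G : groupType) : Prop :=
  forall x y z : G, x <> 1 -> y <> 1 -> z <> 1 ->
    [~ x, y] = 1 -> [~ y, z] = 1 -> [~ x, z] = 1.

Definition residually (X : group_class) (G : groupType) : Prop :=
  forall g : G, g <> 1 ->
    exists2 H : groupType, X H &
      exists phi : {multiplicative G -> H}, phi g <> 1.

Definition fully_residually (X : group_class) (G : groupType) : Prop :=
  forall s : seq G, (forall g, g \in s -> g <> 1) ->
    exists2 H : groupType, X H &
      exists phi : {multiplicative G -> H}, forall g, g \in s -> phi g <> 1.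

(* The property "B X" of a class X. *)
Definition satisfies_B (X : group_class) : Prop :=
  forall G : groupType, ~ abelian_group G ->
    (fully_residually X G <-> residually X G /\ commutative_transitive G).

(* P, with the maps j1 and j2, is the free product of G1 and G2 amalgamating
   the images of A under the embeddings i1 and i2: the pushout of i1 and i2.
   This determines P up to isomorphism, and A is identified with its images. *)
Definition amalgamated_product (A G1 G2 P : groupType)
    (i1 : {multiplicative A -> G1}) (i2 : {multiplicative A -> G2})
    (j1 : {multiplicative G1 -> P}) (j2 : {multiplicative G2 -> P}) : Prop :=
  [/\ injective i1, injective i2,
      forall a, j1 (i1 a) = j2 (i2 a) &
      forall (H : groupType) (f1 : {multiplicative G1 -> H})
             (f2 : {multiplicative G2 -> H}),
        (forall a, f1 (i1 a) = f2 (i2 a)) ->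
        exists h : {multiplicative P -> H},
          [/\ forall x, h (j1 x) = f1 x, forall y, h (j2 y) = f2 y &
              forall h' : {multiplicative P -> H},
                (forall x, h' (j1 x) = f1 x) -> (forall y, h' (j2 y) = f2 y) ->
                h' =1 h]].

Definition malnormal_amalgams (X : group_class) : group_class :=
  fun P : groupType =>
    exists (G1 G2 A : groupType)
           (i1 : {multiplicative A -> G1}) (i2 : {multiplicative A -> G2})
           (j1 : {multiplicative G1 -> P}) (j2 : {multiplicative G2 -> P}),
      [/\ X G1, X G2, malnormal (range i1), malnormal (range i2) &
          amalgamated_product i1 i2 j1 j2].

(* Main.v *)
Require Import Defs.
From HB Require Import structures.
From mathcomp Require Import all_boot.
From mathcomp Require Import boolp classical_sets.
From mathcomp Require Import zify.

(* Everything reduces to one fact about an amalgam P of nonabelian CSA groups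
   over a malnormal subgroup: commutation is transitive on nontrivial elements,
   and x <> 1 commutes with x ^ g only if it commutes with g.  Given this, in a
   nonabelian, commutative transitive group residually of this kind any two
   nontrivial f, g have a conjugate g ^ t with [~ f, g ^ t] <> 1, and iterating this over a
   finite list produces one element whose survival in a quotient forces the
   survival of the whole list.

   For the fact itself, P acts on reduced words in coset representatives, and
   the word length satisfies the four-point condition of the Bass-Serre tree.
   The factors are malnormal in P, so a nontrivial element conjugate into a
   factor has its centralizer in that conjugate.  Any other element is conjugate
   to some x with |x x| = 2 |x| > 0; signed translation length along the axis of
   x embeds the centralizer of x into the integers, and a conjugate of x in it
   is x or x^-1.  The latter case is excluded because a nonabelian CSA group has
   no involutions. *)

Set Implicit Arguments.
Unset Strict Implicit.
Unset Printing Implicit Defensive.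

Local Open Scope group_scope.

(** * Length functions with the four-point property *)

Definition commutation_transitive (G : groupType) : Prop :=
  forall x y z : G, y <> 1 -> commute x y -> commute y z -> commute x z.

(** In a commutation transitive group this amounts to malnormality of the centralizers of nontrivial
    elements. *)
Definition conjugation_rigid (G : groupType) : Prop :=
  forall x g : G, x <> 1 -> commute x (x ^ g) -> commute x g.

Section Morphisms.

Variables (G H : groupType) (f : {multiplicative G -> H}).

Lemma morph1 : f 1 = 1.
Proof. by apply: (@mulgI _ (f 1)); rewrite -gmulfM !mulg1. Qed.

Lemma morphV x : f x^-1 = (f x)^-1.
Proof. by apply: (@mulgI _ (f x)); rewrite -gmulfM !mulgV morph1. Qed.

Lemma morphJ x y : f (x ^ y) = f x ^ f y.
Proof. by rewrite /conjg !gmulfM morphV. Qed.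

Lemma morphR x y : f [~ x, y] = [~ f x, f y].
Proof. by rewrite /commg gmulfM morphV morphJ. Qed.

End Morphisms.

Lemma conjg_fixE (G : groupType) (x y : G) : commute x y -> x ^ y = x.
Proof. by move=> xy; rewrite /conjg xy mulKg. Qed.

Lemma commuteJ (G : groupType) (x y p : G) :
  commute (x ^ p) (y ^ p) <-> commute x y.
Proof.
rewrite /commute -!conjMg; split=> [/conjg_inj //|-> //].
Qed.

Lemma commuteR (G : groupType) (x y z : G) :
  commute x y -> commute x z -> commute x [~ y, z].
Proof.
move=> xy xz.
by rewrite /commg /conjg; do ![apply: commuteM => // | apply: commuteV => //].
Qed.

Section LengthFunction.

Variables (P : groupType) (ell : P -> nat).

Hypothesis ell1 : ell 1 = 0.
Hypothesis ellV : forall x, ell x^-1 = ell x.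
(** For the distance [ell (p^-1 * q)] this is 0-hyperbolicity: among the three pairings of four
    points, the two largest sums of distances agree. *)
Hypothesis four_point : forall p q r s,
  ell (p^-1 * q) + ell (r^-1 * s) <=
  maxn (ell (p^-1 * r) + ell (q^-1 * s)) (ell (p^-1 * s) + ell (q^-1 * r)).

Lemma ellM x y : ell (x * y) <= ell x + ell y.
Proof.
have := four_point x^-1 y 1 1.
by rewrite !invgK invg1 !mulg1 ell1 addn0 ellV maxnn.
Qed.

Lemma ellJ x g : ell (x ^ g) <= ell x + (ell g + ell g).
Proof.
apply: (leq_trans (ellM _ _)); rewrite ellV addnCA leq_add2l; exact: ellM.
Qed.

Lemma ell_leJ x g : ell x <= ell (x ^ g) + (ell g + ell g).
Proof. by have := ellJ (x ^ g) g^-1; rewrite conjgK ellV. Qed.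

(** Tree picture: [x] is a hyperbolic isometry whose axis passes through the base point, and [ell x]
    is its translation length. *)
Definition straight x := 0 < ell x /\ ell (x * x) = ell x + ell x.

Lemma straightX x k : straight x -> ell (x ^+ k) = (k * ell x)%N.
Proof.
move=> [x_gt0 xx].
elim/ltn_ind: k => -[|[|[|k]]] IH; rewrite ?mul0n ?mul1n //.
  by rewrite expg2 xx; lia.
(* The pairing with sum [2 * ell x] is too small to be the maximum, so the other one bounds
   [ell (x ^+ k.+3)] from below; the triangle inequality bounds it from above. *)
have:= four_point 1 (x ^+ k.+2) x (x ^+ k.+3).
have -> : (x ^+ k.+2)^-1 * x ^+ k.+3 = x by rewrite [x ^+ k.+3]expgSr mulKg.
have -> : x^-1 * x ^+ k.+3 = x ^+ k.+2 by rewrite [x ^+ k.+3]expgS mulKg.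
have -> : (x ^+ k.+2)^-1 * x = (x ^+ k.+1)^-1.
  by rewrite expgS invgM mulgVK.
rewrite invg1 !mul1g ellV (IH k.+2) // (IH k.+1) // => le1.
have le2 : ell (x ^+ k.+3) <= ell x + k.+2 * ell x.
  by rewrite -(IH k.+2) // expgS ellM.
move: le1 le2; set N := ell (x ^+ k.+3); rewrite !mulSn; lia.
Qed.

Let d p q := ell (p^-1 * q).

Let dC p q : d p q = d q p.
Proof. by rewrite /d -ellV invgM invgK. Qed.

Let dMl g p q : d (g * p) (g * q) = d p q.
Proof. by rewrite /d invgM -mulgA mulKg. Qed.

Let d1 p : d 1 p = ell p.
Proof. by rewrite /d invg1 mul1g. Qed.

Let dr y u : d y (y * u) = ell u.
Proof. by rewrite /d mulKg. Qed.

Let dl y u : commute y u -> d u (y * u) = ell y.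
Proof. by move=> yu; rewrite /d yu mulKg. Qed.

Let d4 p q r s : d p q + d r s <= maxn (d p r + d q s) (d p s + d q r).
Proof. exact: four_point. Qed.

(** * The centralizer of a straight element *)

Section Centralizer.

Variable x : P.
Hypothesis x_straight : straight x.
Let n := ell x.

Let n_gt0 : 0 < n. Proof. by case: x_straight. Qed.

Let ellX k : ell (x ^+ k) = (k * n)%N. Proof. exact: straightX. Qed.

(** In the quadrilateral [1, X, y * X, y] with [X = x ^+ K], the short sides [ell y] cannot attain
    the maximum, so the diagonals add up to the two long sides. *)
Lemma axis_sum K y : commute x y -> ell y < K * n ->
  ell (x ^+ K * y) + ell (x ^- K * y) = (K * n + K * n)%N.
Proof.
move=> xy y_lt; set X := x ^+ K.
have yX : commute y X by apply/commuteX/commute_sym.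
have e1 : d 1 X = (K * n)%N by rewrite d1 ellX.
have e2 : d y (y * X) = (K * n)%N by rewrite dr ellX.
have e3 : d 1 y = ell y by rewrite d1.
have e4 : d X (y * X) = ell y by rewrite dl.
have e5 : d 1 (y * X) = ell (X * y) by rewrite d1 yX.
have e6 : d X y = ell (X^-1 * y) by [].
have := d4 1 X y (y * X); have := d4 1 (y * X) y X.
rewrite (dC (y * X) X) (dC (y * X) y) (dC y X) e1 e2 e3 e4 e5 e6.
lia.
Qed.

(** The base point is the midpoint of [X^-1] and [X], and the four-point condition puts [y] on the
    axis through them. So [ell y] is the absolute value of the signed translation length
    [ell (x ^+ K * y) - K * n]. *)
Lemma axis_length K y : commute x y -> ell y < K * n ->
  ell (x ^+ K * y) = (K * n + ell y)%N \/ ell (x ^+ K * y) + ell y = (K * n)%N.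
Proof.
move=> xy y_lt; have := axis_sum xy y_lt; set X := x ^+ K => sum.
have e1 : d X^-1 X = (K * n + K * n)%N.
  by rewrite /d invgK /X -expgnDr ellX mulnDl.
have e2 : d 1 y = ell y by rewrite d1.
have e3 : d 1 X^-1 = (K * n)%N by rewrite d1 ellV ellX.
have e4 : d 1 X = (K * n)%N by rewrite d1 ellX.
have e5 : d y X^-1 = ell (X * y) by rewrite dC /d invgK.
have e6 : d y X = ell (X^-1 * y) by rewrite dC.
have := d4 1 y X^-1 X; have := d4 1 X^-1 y X; have := d4 1 X y X^-1.
rewrite (dC X^-1 y) (dC X X^-1) (dC X y) e1 e2 e3 e4 e5 e6.
lia.
Qed.

(* The Busemann-type cocycle [ell (x ^+ K * y) - K * n] of the axis of [x] is
   additive on the centralizer of [x]; stated without subtraction. *)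
Lemma axis_additive K y z : commute x y -> commute x z ->
  ell y + ell z < K * n ->
  ell (x ^+ K * (y * z)) + K * n = (ell (x ^+ K * y) + ell (x ^+ K * z))%N.
Proof.
move=> xy xz lt.
have [y_lt z_lt] : ell y < K * n /\ ell z < K * n by lia.
have := axis_length xy y_lt; have := axis_length xz z_lt.
set X := x ^+ K => hz hy; set u := X^-1.
have yu : commute y u by apply/commuteV/commuteX/commute_sym.
have e1 : d u y = ell (X * y) by rewrite /d invgK.
have e2 : d (y * u) (y * z) = ell (X * z) by rewrite dMl /d invgK.
have e3 : d u (y * z) = ell (X * (y * z)) by rewrite /d invgK.
have e4 : d y (y * u) = (K * n)%N by rewrite dr ellV ellX.
have e5 : d u (y * u) = ell y by rewrite dl.
have e6 : d y (y * z) = ell z by rewrite dr.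
(* The pairing [ell y + ell z] stays below [K * n], so the other two pairings are equal. *)
have := d4 u y (y * u) (y * z); have := d4 u (y * z) (y * u) y.
rewrite (dC (y * z) y) (dC (y * z) (y * u)) (dC (y * u) y) e1 e2 e3 e4 e5 e6.
lia.
Qed.

Lemma axis_power K z j : commute x z -> (j + 2) * ell z < K * n ->
  ell (x ^+ K * z ^+ j) + j * (K * n) = (K * n + j * ell (x ^+ K * z))%N.
Proof.
move=> xz; elim: j => [|j IH] lt; first by rewrite mulg1 ellX; lia.
have lej k : ell (z ^+ k) <= k * ell z.
  elim: k => [|k IHk]; first by rewrite ell1.
  by rewrite expgS mulSn (leq_trans (ellM _ _)) ?leq_add2l.
have xzj : commute x (z ^+ j) by apply: commuteX.
have := @axis_additive K z (z ^+ j) xz xzj.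
rewrite -expgS; have := lej j; move: IH lt.
rewrite !mulnDl !mulSn.
move: (ell (z ^+ j)) (ell (x ^+ K * z ^+ j)) (ell (x ^+ K * z ^+ j.+1)).
lia.
Qed.

(** Signed translation length is multiplied by [j] according to [axis_power], and [axis_length]
    recovers the absolute values. *)
Lemma ell_centralizer_power z j : commute x z -> ell (z ^+ j) = (j * ell z)%N.
Proof.
move=> xz.
(* As [0 < n], the successor makes [K * n] exceed the sum it is built from. *)
pose K := ((j + 2) * ell z + ell (z ^+ j)).+1.
have K_lt : (j + 2) * ell z + ell (z ^+ j) < K * n.
  by rewrite /K mulSn; nia.
have z_lt : ell z < K * n by lia.
have zj_lt : ell (z ^+ j) < K * n by lia.
have := @axis_power K z j xz.
have := axis_length (commuteX j xz) zj_lt; have := axis_length xz z_lt.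
move: (ell (z ^+ j)) (ell (x ^+ K * z ^+ j)) (ell (x ^+ K * z)) K_lt.
nia.
Qed.

(** Signed translation length is additive with integer values, so it vanishes on commutators. *)
Lemma ell_commutator y z : commute x y -> commute x z -> ell [~ y, z] = 0.
Proof.
move=> xy xz.
have xc : commute x [~ y, z] by apply: commuteR.
have xyz : commute x (y * z) by apply: commuteM.
have xzy : commute x (z * y) by apply: commuteM.
pose K := (ell y + ell z + ell (z * y) + ell [~ y, z]).+1.
have K_lt : ell y + ell z + ell (z * y) + ell [~ y, z] < K * n.
  by rewrite /K mulSn; nia.
have h1 := @axis_additive K y z xy xz.
have h2 := @axis_additive K z y xz xy.
have h3 := @axis_additive K (z * y) [~ y, z] xzy xc.
have c_lt : ell [~ y, z] < K * n by lia.
have := axis_length xc c_lt.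
rewrite -commgC in h3; lia.
Qed.

(** Conjugation changes the lengths of all powers by a bounded amount, so [x ^ g] has length [n] as
    well. Its signed translation length is thus [n] or [-n], and one of the two products has signed
    length 0. *)
Lemma ell_centralizer_conj g : commute x (x ^ g) ->
  ell (x ^ g * x) = 0 \/ ell ((x ^ g)^-1 * x) = 0.
Proof.
set z := x ^ g => xz.
have elln : ell z = n.
  have pow j : ell (z ^+ j) <= j * n + (ell g + ell g) /\
               j * n <= ell (z ^+ j) + (ell g + ell g).
    by rewrite -ellX -conjXg ellJ ell_leJ.
  have [] := pow (ell g + ell g).+1; rewrite ell_centralizer_power //; nia.
have xV : commute x z^-1 by apply: commuteV.
have xx : commute x x by [].
have xzx : commute x (z * x) by apply: commuteM.
have xVzx : commute x (z^-1 * x) by apply: commuteM.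
pose K := (n + n + n + ell (z * x) + ell (z^-1 * x)).+1.
have K_lt : n + n + n + ell (z * x) + ell (z^-1 * x) < K * n.
  by rewrite /K mulSn; nia.
have h1 := @axis_additive K z x xz xx.
have h2 := @axis_additive K z (z^-1 * x) xz xVzx.
have ex : ell (x ^+ K * x) = (K * n + n)%N by rewrite -expgSr ellX mulSn addnC.
rewrite mulVKg in h2.
have l1 : ell z < K * n by lia.
have l2 : ell (z * x) < K * n by lia.
have l3 : ell (z^-1 * x) < K * n by lia.
have := axis_length xz l1; have := axis_length xzx l2.
have := axis_length xVzx l3.
rewrite ex -/n in h1 h2; rewrite elln in l1 h1 h2 *.
move: h1 h2 K_lt l1 l2 l3.
move: (ell (x ^+ K * (z^-1 * x))) (ell (x ^+ K * (z * x))) (ell (x ^+ K * z)).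
move: (ell (z * x)) (ell (z^-1 * x)).
lia.
Qed.

End Centralizer.

(** * Transitivity and rigidity from a length function and a malnormal family *)

Section Criterion.

(** [V] is meant to be the family of images of the two factors in the amalgam. *)
Variables (I : Type) (V : I -> P -> Prop).

Hypothesis VM : forall b x y, V b x -> V b y -> V b (x * y).
Hypothesis V_malnormal : forall b x g, V b x -> x <> 1 -> V b (x ^ g) -> V b g.
Hypothesis V_trans : forall b x y z, V b x -> V b y -> V b z ->
  y <> 1 -> commute x y -> commute y z -> commute x z.
Hypothesis V_rigid : forall b x g, V b x -> V b g ->
  x <> 1 -> commute x (x ^ g) -> commute x g.
Hypothesis V_no_involution : forall b x, V b x -> x * x = 1 -> x = 1.
Hypothesis ell_V : forall b x, V b x -> ell x <= 1.
Hypothesis ell0_V : forall x, ell x = 0 -> exists b, V b x.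
Hypothesis V_or_straight : forall x, exists p,
  (exists b, V b (x ^ p)) \/ straight (x ^ p).

Let V_centralizer b x y : V b x -> x <> 1 -> commute y x -> V b y.
Proof.
move=> Vx x1 yx; apply: V_malnormal (Vx) x1 _.
by rewrite conjg_fixE //; apply: commute_sym.
Qed.

(** Powers of [x] grow linearly and conjugation by [p] shortens them by at most [2 * ell p], while
    [V b] is closed under products and has lengths at most 1. *)
Lemma straight_notV x b p : straight x -> ~ V b (x ^ p).
Proof.
move=> xs Vxp.
have VX j : V b ((x ^ p) ^+ j.+1).
  by elim: j => // j IH; rewrite expgS; apply: VM.
have := ell_V (VX (ell p + ell p).+1).
rewrite -conjXg; have := ell_leJ (x ^+ (ell p + ell p).+2) p.
rewrite straightX //; case: xs; nia.
Qed.

(** A nontrivial [y] of length 0 would lie in some [V b], which would then contain the centralizer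
    of [y], hence [x]. *)
Lemma straight_centralizer_ell0 x y :
  straight x -> commute x y -> ell y = 0 -> y = 1.
Proof.
move=> xs xy /ell0_V[b Vy]; apply: contrapT => y1.
by apply: (@straight_notV x b 1 xs); rewrite conjg1; apply: V_centralizer Vy y1 xy.
Qed.

Lemma straight_centralizer_abelian x y z :
  straight x -> commute x y -> commute x z -> commute y z.
Proof.
move=> xs xy xz; apply/commgP/eqP.
apply: (straight_centralizer_ell0 xs); last exact: (@ell_commutator x xs).
exact: commuteR.
Qed.

Lemma criterion_transitive : commutation_transitive P.
Proof.
move=> x y z y1 xy yz; have [p] := V_or_straight y.
rewrite -(commuteJ x z p).
have y1p : y ^ p <> 1 by move/eqP; rewrite conjg_eq1 => /eqP.
have xyp : commute (x ^ p) (y ^ p) by apply/commuteJ.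
have yzp : commute (y ^ p) (z ^ p) by apply/commuteJ.
case=> [[b Vy]|ys].
  apply: (V_trans _ Vy _ y1p xyp yzp).
- exact: V_centralizer Vy y1p xyp.
- apply: V_centralizer Vy y1p _; exact: commute_sym.
apply: straight_centralizer_abelian ys _ yzp; exact: commute_sym.
Qed.

(** By [ell_centralizer_conj], [x ^ g] is [x] or [x^-1]. In the second case [g * g] commutes with
    [x]. If [g] is conjugate into [V b], then [g * g = 1], since otherwise [x] would be conjugate
    into [V b] too, and [g = 1] for lack of involutions. If a conjugate of [g] is straight, so is
    that of [g * g], whose abelian centralizer contains those of [x] and [g]. *)
Lemma straight_rigid x g : straight x -> commute x (x ^ g) -> commute x g.
Proof.
move=> xs xxg; have xx : commute x x by [].
have xV : commute x (x ^ g)^-1 by apply: commuteV.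
have [/straight_centralizer_ell0 e|/straight_centralizer_ell0 e] :=
  ell_centralizer_conj xs xxg; last first.
  have {}e : (x ^ g)^-1 * x = 1 by apply: e xs _; apply: commuteM.
  apply/commgP; rewrite -conjg_fix; apply/eqP.
  by rewrite -[RHS](mulKg (x ^ g)^-1) e invgK mulg1.
have {}e : x ^ g * x = 1 by apply: e xs _; apply: commuteM.
have xgE : x ^ g = x^-1 by apply/eqP; rewrite -mulg_eq1 e.
have xg2 : commute x (g * g).
  by apply/commgP; rewrite -conjg_fix conjgM xgE conjVg xgE invgK.
have [p [[b Vg]|gs]] := V_or_straight g.
  have Vgg : V b ((g * g) ^ p) by rewrite conjMg; apply: VM.
  have gg1 : (g * g) ^ p = 1.
    apply: contrapT => gg1; apply: (@straight_notV x b p xs).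
    by apply: V_centralizer Vgg gg1 _; apply/commuteJ.
  have /eqP : g ^ p = 1 by apply: (V_no_involution Vg); rewrite -conjMg.
  by rewrite conjg_eq1 => /eqP ->; apply: commute1.
have ggs : straight ((g * g) ^ p).
  have [g_gt0 ell_gg] := gs.
  have := straightX 2 gs; have := straightX 4 gs.
  rewrite (expgnDr _ 2 2) expg2 -!conjMg /straight -conjMg => -> ->; lia.
apply/(commuteJ _ _ p); apply: straight_centralizer_abelian ggs _ _.
  by apply/commuteJ; apply: commute_sym.
by apply/commuteJ; apply: commute_sym; apply: commuteM.
Qed.

Lemma criterion_rigid : conjugation_rigid P.
Proof.
move=> x g x1; have [p] := V_or_straight x.
rewrite -(commuteJ x (x ^ g) p) -(commuteJ x g p) conjJg.
have x1p : x ^ p <> 1 by move/eqP; rewrite conjg_eq1 => /eqP.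
case=> [[b Vx]|xs] xxg; last exact: straight_rigid.
apply: (V_rigid Vx _ x1p xxg); apply: (V_malnormal Vx x1p).
by apply: (V_centralizer Vx x1p); apply: commute_sym.
Qed.

End Criterion.

End LengthFunction.

(** * Groups of bijections, the targets for the universal property of the amalgam *)

Record bijection (T : Type) := Bijection {
  bij_fun :> T -> T;
  bij_inv : T -> T;
  bij_funK : cancel bij_fun bij_inv;
  bij_invK : cancel bij_inv bij_fun }.

Section BijectionGroup.

Variable T : Type.

Lemma bijectionP (f g : bijection T) : f =1 g -> f = g.
Proof.
case: f g => [f f' fK f'K] [g g' gK g'K] /= /funext fg; subst g.
have e : f' = g' by apply: funext => x; rewrite -{1}(g'K x) fK.
by subst g'; rewrite (Prop_irrelevance fK gK) (Prop_irrelevance f'K g'K).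
Qed.

HB.instance Definition _ := gen_eqMixin (bijection T).
HB.instance Definition _ := gen_choiceMixin (bijection T).

Definition bij_one := @Bijection T id id (fun=> erefl) (fun=> erefl).
Definition bij_mul (f g : bijection T) :=
  Bijection (can_comp (bij_funK f) (bij_funK g))
            (can_comp (bij_invK g) (bij_invK f)).
Definition bij_opp (f : bijection T) := Bijection (bij_invK f) (bij_funK f).

Fact bij_mulA : associative bij_mul.
Proof. by move=> f g h; apply: bijectionP. Qed.
Fact bij_mul1 : left_id bij_one bij_mul.
Proof. by move=> f; apply: bijectionP. Qed.
Fact bij_mulr1 : right_id bij_one bij_mul.
Proof. by move=> f; apply: bijectionP. Qed.
Fact bij_mulV : left_inverse bij_one bij_opp bij_mul.
Proof. by move=> f; apply: bijectionP => x; apply: bij_funK. Qed.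
Fact bij_mulrV : right_inverse bij_one bij_opp bij_mul.
Proof. by move=> f; apply: bijectionP => x; apply: bij_invK. Qed.

HB.instance Definition _ := isGroup.Build (bijection T)
  bij_mulA bij_mul1 bij_mulr1 bij_mulV bij_mulrV.

End BijectionGroup.

(** * The action on reduced words *)

Section Amalgam.

(** Indexing the factors by [bool] lets one argument serve both. *)
Variables (A : groupType) (G : bool -> groupType).
Variable i : forall b, {multiplicative A -> G b}.
Hypothesis i_inj : forall b, injective (i b).

Section Cosets.

Variable b : bool.
Implicit Types (g h : G b) (a : A).

Definition base g : Prop := exists a, g = i b a.

Lemma baseM g h : base g -> base h -> base (g * h).
Proof. by move=> [a ->] [c ->]; exists (a * c); rewrite gmulfM. Qed.

Lemma baseV g : base g -> base g^-1.
Proof. by move=> [a ->]; exists a^-1; rewrite morphV. Qed.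

Lemma base1 : base 1.
Proof. by exists 1; rewrite morph1. Qed.

(** A transversal of the left cosets of [A]. The coset [A] itself gets 1, so that its letter can be
    recognized and dropped from words. *)
Definition rep g : G b :=
  if `[< base g >] then 1 else choose (fun h => `[< base (g^-1 * h) >]) g.

Lemma rep_base g : base (g^-1 * rep g).
Proof.
rewrite /rep; case: ifPn => [/asboolP|_].
  by move=> /baseV; rewrite mulg1.
apply/asboolP.
have := @chooseP _ (fun h => `[< base (g^-1 * h) >]) g.
by apply; apply/asboolP; rewrite mulVg; apply: base1.
Qed.

Lemma ex_tail g : exists a, g = rep g * i b a.
Proof.
have [a ga] := baseV (rep_base g).
by exists a; rewrite -ga invgM invgK mulVKg.
Qed.

Definition tail g : A := projT1 (cid (ex_tail g)).

Lemma repE g : g = rep g * i b (tail g).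
Proof. exact: projT2 (cid (ex_tail g)). Qed.

Lemma base_coset g h k : base (g^-1 * h) -> base (g^-1 * k) -> base (h^-1 * k).
Proof.
move=> gh gk; have -> : h^-1 * k = (g^-1 * h)^-1 * (g^-1 * k).
  by rewrite invgM invgK -mulgA mulVKg.
by apply: baseM => //; apply: baseV.
Qed.

Lemma base_rep g : base g -> rep g = 1.
Proof. by move=> bg; rewrite /rep asboolT. Qed.

(** The predicates given to [choose] agree along a coset, and [choose_id] removes the dependence on
    the starting point. *)
Lemma rep_eq g h : base (g^-1 * h) -> rep g = rep h.
Proof.
move=> gh.
have gg : base (g^-1 * g) by rewrite mulVg; apply: base1.
have hg := base_coset gh gg.
have [bg|bg] := pselect (base g).
  by rewrite !base_rep // -[h](mulVKg g); apply: baseM.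
have bh : ~ base h.
  by move=> bh; apply: bg; rewrite -[g](mulVKg h); apply: baseM.
rewrite /rep !asboolF //.
have e k : `[< base (g^-1 * k) >] = `[< base (h^-1 * k) >].
  by apply: asbool_equiv_eq; split; apply: base_coset.
by rewrite (eq_choose e); apply: choose_id; rewrite -e; apply/asboolP.
Qed.

Lemma rep_baseM g a : rep (g * i b a) = rep g.
Proof. by apply/esym/rep_eq; rewrite mulKg; exists a. Qed.

Lemma repM g h : rep (g * h) = rep (g * rep h).
Proof. by rewrite {1}[h]repE mulgA rep_baseM. Qed.

Lemma rep_rep g : rep (rep g) = rep g.
Proof. by rewrite -[rep g in LHS]mul1g -repM mul1g. Qed.

Lemma tail_rep t a : rep t = t -> tail (t * i b a) = a.
Proof.
move=> tt; have := repE (t * i b a).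
by rewrite rep_baseM tt => /mulgI /i_inj.
Qed.

(** The cocycle identity: both sides complete [rep (g * h)] to [g * h]. *)
Lemma tailM g h : tail (g * h) = tail (g * rep h) * tail h.
Proof.
apply: i_inj; rewrite gmulfM; apply: (@mulgI _ (rep (g * h))).
by rewrite -repE mulgA repM -repE -mulgA -repE.
Qed.

Lemma rep1 : rep 1 = 1.
Proof. exact/base_rep/base1. Qed.

Lemma tail_base a : tail (i b a) = a.
Proof. by rewrite -[i b a]mul1g tail_rep ?rep1. Qed.

Lemma tail1 : tail 1 = 1.
Proof. by rewrite -(morph1 (i b)) tail_base. Qed.

Lemma rep_eq1 g : rep g = 1 -> base g.
Proof. by move=> g1; exists (tail g); rewrite {1}[g]repE g1 mul1g. Qed.

Lemma tail_id t : rep t = t -> tail t = 1.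
Proof. by move=> tt; rewrite -[t]mulg1 -(morph1 (i b)) tail_rep. Qed.

End Cosets.

Notation letter := {b : bool & G b}.

(** Rewriting to normal form: [a], standing to the left of [l], is carried through the letters, each
    of which becomes a coset representative again, and comes out on the right. *)
Fixpoint push (a : A) (l : seq letter) : seq letter * A :=
  if l is existT b t :: l' then
    let p := push (tail (i b a * t)) l' in
    (existT G b (rep (i b a * t)) :: p.1, p.2)
  else ([::], a).

Lemma pushM a c l : push (a * c) l =
  ((push a (push c l).1).1, (push a (push c l).1).2 * (push c l).2).
Proof.
elim: l a c => [//|[b t] l IH] a c /=.
by rewrite gmulfM -mulgA (tailM _ (i b c * t)) -(repM (i b a)) IH.
Qed.

(* The factor [b] excluded for the first letter is that of the letter before. *)
Fixpoint alternating (b : bool) (l : seq letter) : bool :=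
  if l is u :: l' then
    [&& tag u != b, rep (tagged u) == tagged u, tagged u != 1
      & alternating (tag u) l']
  else true.

Definition reduced l := alternating true l || alternating false l.

Lemma alternating_reduced b l : alternating b l -> reduced l.
Proof. by rewrite /reduced; case: b => ->; rewrite ?orbT. Qed.

Lemma rep_neq1 b a (t : G b) : rep t = t -> t <> 1 -> rep (i b a * t) <> 1.
Proof.
move=> tt t1 /rep_eq1 bt; apply: t1; rewrite -tt; apply: base_rep.
rewrite -[t](mulKg (i b a)); apply: baseM => //; apply: baseV; by exists a.
Qed.

Lemma push_alternating a b l : alternating b l -> alternating b (push a l).1.
Proof.
elim: l a b => [//|[b' t] l IH] a b /= /and4P[-> /eqP tt /eqP t1 Hl].
by rewrite rep_rep eqxx IH // andbT /=; apply/eqP/rep_neq1.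
Qed.

Lemma push1 b l : alternating b l -> push 1 l = (l, 1).
Proof.
elim: l b => [//|[b' t] l IH] b /= /and4P[_ /eqP tt _ Hl].
by rewrite morph1 mul1g tail_id // (IH _ Hl) tt.
Qed.

Lemma size_push a l : size (push a l).1 = size l.
Proof. by elim: l a => [//|[b t] l IH] a /=; rewrite IH. Qed.

(** A trivial letter is not written. With this convention every reduced word splits uniquely, for
    either [b], into a representative in [G b] and a word not starting in [G b]. *)
Definition cons_rep b (t : G b) (l : seq letter) : seq letter :=
  if t == 1 then l else existT G b t :: l.

Definition split_head b (l : seq letter) : G b * seq letter :=
  if l is u :: l' then
    if tag u == b then (tagged_as (existT G b 1) u, l') else (1, l)
  else (1, [::]).

Lemma split_cons b t l : alternating b l -> split_head b (cons_rep t l) = (t, l).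
Proof.
rewrite /cons_rep; case: eqVneq => [-> |_ _] /=.
  by case: l => [//|u l] /= /and4P[/negPf ->].
by rewrite eqxx; congr (_, _); exact: (@tagged_asE _ _ (existT G b 1) t).
Qed.

Lemma reduced_cons b (t : G b) l :
  rep t = t -> alternating b l -> reduced (cons_rep t l).
Proof.
move=> tt Hl; rewrite /cons_rep; case: eqP => [_|/eqP t1].
  exact: alternating_reduced Hl.
by apply: (@alternating_reduced (~~ b)); rewrite /= tt eqxx t1 Hl; case: (b).
Qed.

Lemma reduced_split b l : reduced l ->
  exists t l', [/\ rep t = t, alternating b l' & l = @cons_rep b t l'].
Proof.
move=> Hl; have triv : alternating b l ->
    exists t l', [/\ rep t = t, alternating b l' & l = @cons_rep b t l'].
  by move=> bl; exists 1, l; rewrite rep1 /cons_rep eqxx.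
case: l Hl triv => [|[b' t] l] Hl triv; first exact: triv.
have {}Hl : [&& rep t == t, t != 1 & alternating b' l].
  by case/orP: Hl => /= /and4P[_ -> -> ->].
have [e|b'b] := eqVneq b' b; last by apply: triv; rewrite /= b'b.
subst b'; have /and3P[/eqP tt t1 ll] := Hl.
by exists t, l; rewrite /cons_rep (negPf t1).
Qed.

(** Left multiplication on normal forms: [g] is absorbed by the letter from [G b], and the resulting
    tail is pushed through to the final element of [A]. *)
Definition gact b (g : G b) (w : seq letter * A) : seq letter * A :=
  let s := split_head b w.1 in
  let p := push (tail (g * s.1)) s.2 in
  (cons_rep (rep (g * s.1)) p.1, p.2 * w.2).

Lemma reduced_pair b (w : seq letter * A) : reduced w.1 ->
  exists t l c, [/\ rep t = t, alternating b l & w = (@cons_rep b t l, c)].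
Proof.
case: w => l c /(reduced_split b)[t [l' [tt bl e]]].
by exists t, l', c; split=> //; congr (_, _).
Qed.

Lemma gact_cons b (g t : G b) l c : alternating b l ->
  gact g (cons_rep t l, c) =
  (cons_rep (rep (g * t)) (push (tail (g * t)) l).1, (push (tail (g * t)) l).2 * c).
Proof. by move=> bl; rewrite /gact /= split_cons. Qed.

Lemma gact_reduced b (g : G b) w : reduced w.1 -> reduced (gact g w).1.
Proof.
move=> /(reduced_pair b)[t [l [c [_ bl ->]]]].
by rewrite gact_cons //=; apply: reduced_cons; rewrite ?rep_rep ?push_alternating.
Qed.

Lemma gact1 b w : reduced w.1 -> @gact b 1 w = w.
Proof.
move=> /(reduced_pair b)[t [l [c [tt bl ->]]]].
by rewrite gact_cons // mul1g tt tail_id // (push1 bl) mul1g.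
Qed.

Lemma gactM b (g h : G b) w : reduced w.1 -> gact (g * h) w = gact g (gact h w).
Proof.
move=> /(reduced_pair b)[t [l [c [tt bl ->]]]].
rewrite !gact_cons ?push_alternating //.
by rewrite -(mulgA g) (tailM g (h * t)) -(repM g (h * t)) pushM /= -[in LHS]mulgA.
Qed.

Lemma gact_base b a w : reduced w.1 ->
  gact (i b a) w = ((push a w.1).1, (push a w.1).2 * w.2).
Proof.
move=> /(reduced_pair b)[t [l [c [tt bl ->]]]].
rewrite gact_cons // /cons_rep; case: (eqVneq t 1) => [->|/eqP t1].
  by rewrite mulg1 tail_base base_rep ?eqxx //; exists a.
by case: eqP => // /rep_neq1; case.
Qed.

(** Extended by the identity off the reduced words, so as to be a bijection of the whole type. *)
Definition act b (g : G b) w := if reduced w.1 then gact g w else w.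

Lemma actM b (g h : G b) w : act (g * h) w = act g (act h w).
Proof.
rewrite /act; case: ifP => [rw|->//].
by rewrite gact_reduced // gactM.
Qed.

Lemma act1 b w : @act b 1 w = w.
Proof. by rewrite /act; case: ifP => // rw; rewrite gact1. Qed.

Lemma actK b (g : G b) : cancel (act g) (act g^-1).
Proof. by move=> w; rewrite -actM mulVg act1. Qed.

Lemma actVK b (g : G b) : cancel (act g^-1) (act g).
Proof. by move=> w; rewrite -actM mulgV act1. Qed.

Definition word_action b (g : G b) : bijection (seq letter * A) :=
  Bijection (actK g) (actVK g).

Lemma word_actionM b : {morph @word_action b : g h / g * h}.
Proof. by move=> g h; apply: bijectionP => w; apply: actM. Qed.

HB.instance Definition _ b :=
  isMultiplicative.Build _ _ (@word_action b) (@word_actionM b).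

(** Elements of [A] act by [push], whichever factor they are taken in; this is the compatibility
    that the universal property asks for. *)
Lemma word_action_base a b b' : word_action (i b a) = word_action (i b' a).
Proof.
by apply: bijectionP => w /=; rewrite /act; case: ifP => // rw; rewrite !gact_base.
Qed.

(** * The tree metric on reduced words *)

Fixpoint overlap (l m : seq letter) : nat :=
  match l, m with
  | u :: l', v :: m' =>
    if tag u != tag v then 0 else if u == v then (overlap l' m').+2 else 1%N
  | _, _ => 0
  end.

(** The length of the inverse of [l] times [m]: a common letter cancels twice, and the first
    distinct letters merge into one if they lie in the same factor. [overlap] is twice the Gromov
    product at the empty word. *)
Definition dist l m := size l + size m - overlap l m.

Lemma overlapC l m : overlap l m = overlap m l.
Proof.
by elim: l m => [|u l IH] [|v m] //=; rewrite [tag v == _]eq_sym [v == u]eq_sym IH.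
Qed.

Lemma overlap_ultra l k m : minn (overlap l k) (overlap k m) <= overlap l m.
Proof.
elim: k l m => [|w k IH] [|u l] [|v m] //=; rewrite ?minn0 ?min0n //.
case: (eqVneq (tag u) (tag w)) => [uw|//=]; last by rewrite min0n.
rewrite -uw; case: (eqVneq (tag u) (tag v)) => [uv|//=] /=.
case: (eqVneq u w) => [->|uwn]; case: (eqVneq w v) => [wv|wv] /=.
- by rewrite !minnSS !ltnS; apply: IH.
- by lia.
- by rewrite -wv (negPf uwn); lia.
- by case: ifP => _; lia.
Qed.

(** Makes the truncated subtraction in [dist] exact. *)
Lemma overlap_le l m : overlap l m <= size l + size m.
Proof.
elim: l m => [|u l IH] [|v m] //=; case: ifP => // _; case: ifP => // _.
by have := IH m; lia.
Qed.

Lemma distC l m : dist l m = dist m l.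
Proof. by rewrite /dist addnC overlapC. Qed.

Lemma dist_nil m : dist [::] m = size m.
Proof. by rewrite /dist subn0. Qed.

Lemma overlap_four_point p q r s :
  minn (overlap p r + overlap q s) (overlap p s + overlap q r) <=
  overlap p q + overlap r s.
Proof.
have := overlap_ultra p r q; have := overlap_ultra p s q.
have := overlap_ultra r p s; have := overlap_ultra r q s.
rewrite (overlapC r p) (overlapC r q) (overlapC s q).
move: (overlap p q) (overlap p r) (overlap p s) => pq pr ps.
move: (overlap q r) (overlap q s) (overlap r s) => qr qs rs.
lia.
Qed.

Lemma dist_four_point p q r s :
  dist p q + dist r s <= maxn (dist p r + dist q s) (dist p s + dist q r).
Proof.
have := overlap_four_point p q r s; rewrite /dist.
have := overlap_le p q; have := overlap_le p r; have := overlap_le p s.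
have := overlap_le q r; have := overlap_le q s; have := overlap_le r s.
move: (overlap p q) (overlap p r) (overlap p s) => pq pr ps.
move: (overlap q r) (overlap q s) (overlap r s) => qr qs rs.
move: (size p) (size q) (size r) (size s) => np nq nr ns.
lia.
Qed.

Lemma eq_letter b (t s : G b) : (existT G b t == existT G b s) = (t == s).
Proof. exact: (@eq_Tagged _ _ (existT G b t) s). Qed.

Lemma rep_mulI b (g t s : G b) :
  rep t = t -> rep s = s -> (rep (g * t) == rep (g * s)) = (t == s).
Proof.
move=> tt ss; apply/eqP/eqP => [e|->//].
by rewrite -tt -ss -[t](mulKg g) -[s](mulKg g) [LHS]repM e -repM.
Qed.

Lemma overlap_push a b b' l m : alternating b l -> alternating b' m ->
  overlap (push a l).1 (push a m).1 = overlap l m.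
Proof.
elim: l m a b b' => [|[c t] l IH] [|[c' s] m] a b b' //=.
move=> /and4P[_ /eqP tt t1 ll] /and4P[_ /eqP ss s1 mm].
case: (eqVneq c c') => //= e; subst c'.
rewrite !eq_letter rep_mulI //; case: eqP => // e; subst s.
by rewrite (IH _ _ c c).
Qed.

Lemma dist_push a b b' l m : alternating b l -> alternating b' m ->
  dist (push a l).1 (push a m).1 = dist l m.
Proof. by move=> ll mm; rewrite /dist !size_push (overlap_push _ ll mm). Qed.

(** If [t] and [s] differ, one letter remains between [l] and [m], whether two letters merge or one
    of them is the unwritten trivial letter. *)
Lemma dist_cons_rep b (t s : G b) l m : alternating b l -> alternating b m ->
  dist (cons_rep t l) (cons_rep s m) =
  if t == s then dist l m else (size l + size m).+1.
Proof.
move=> ll mm; rewrite /dist /cons_rep.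
case: (eqVneq t 1) => [->|t1]; case: (eqVneq s 1) => [s1|s1] //.
- case: l ll => [|u l] /=; first by lia.
  by move=> /andP[/negPf ->] /=; lia.
- rewrite s1 (negPf t1); case: m mm => [|u m] /=; first by lia.
  by rewrite [b == _]eq_sym => /andP[/negPf ->] /=; lia.
- rewrite /= eqxx /= eq_letter; case: eqVneq => _; lia.
Qed.

Lemma dist_gact b (g : G b) w w' : reduced w.1 -> reduced w'.1 ->
  dist (gact g w).1 (gact g w').1 = dist w.1 w'.1.
Proof.
move=> /(reduced_pair b)[t [l [c [tt bl ->]]]].
move=> /(reduced_pair b)[s [m [d [ss bm ->]]]].
rewrite !gact_cons // !dist_cons_rep ?push_alternating // !size_push rep_mulI //.
by case: eqP => // ->; rewrite (dist_push _ bl bm).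
Qed.

(** * The amalgam and its length function *)

Section Pushout.

Variables (P : groupType) (j : forall b, {multiplicative G b -> P}).
Hypothesis j_base : forall b b' a, j b (i b a) = j b' (i b' a).
Hypothesis j_epi : forall (H : groupType) (h h' : {multiplicative P -> H}),
  (forall b x, h (j b x) = h' (j b x)) -> h =1 h'.

Section Generation.

Variable S : P -> Prop.
Hypothesis S1 : S 1.
Hypothesis SM : forall x y, S x -> S y -> S (x * y).
Hypothesis SV : forall x, S x -> S x^-1.
Hypothesis Sj : forall b x, S (j b x).

Let translate (g : P) (w : P * bool) := (g * w.1, w.2).

Let translateK g : cancel (translate g) (translate g^-1).
Proof. by case=> x e; rewrite /translate /= mulKg. Qed.

Let translateVK g : cancel (translate g^-1) (translate g).
Proof. by case=> x e; rewrite /translate /= mulVKg. Qed.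

Let left_action g : bijection (P * bool) :=
  Bijection (translateK g) (translateVK g).

Let left_actionM : {morph left_action : g h / g * h}.
Proof.
by move=> g h; apply: bijectionP => -[x e]; rewrite /= /translate /= mulgA.
Qed.

Let swap (w : P * bool) := (w.1, `[< S w.1 >] (+) w.2).

Let swapK : involutive swap.
Proof. by case=> x e; rewrite /swap /= addKb. Qed.

Let twist : bijection (P * bool) := Bijection swapK swapK.

Let twisted_action g := left_action g ^ twist.

Let twisted_actionM : {morph twisted_action : g h / g * h}.
Proof. by move=> g h; rewrite /twisted_action left_actionM conjMg. Qed.

(* Translation commutes with the swap of the two copies of [S] exactly for the
   elements of [S], and uniqueness of factorizations extends this from the
   images of the factors to all of [P]. *)
Lemma factors_generate p : S p.
Proof.
pose h : {multiplicative P -> bijection (P * bool)} :=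
  HB.pack left_action (isMultiplicative.Build _ _ left_action left_actionM).
pose h' : {multiplicative P -> bijection (P * bool)} :=
  HB.pack twisted_action
    (isMultiplicative.Build _ _ twisted_action twisted_actionM).
have hh' : h =1 h'.
  apply: j_epi => b x; apply: bijectionP => -[y e].
  have Sxy : S (j b x * y) <-> S y.
    split=> [Sxy|]; last exact: SM.
    by rewrite -[y](mulKg (j b x)); apply: SM => //; apply: SV.
  rewrite /= /swap /translate /=; congr (_, _).
  by rewrite (asbool_equiv_eq Sxy) addKb.
have := congr1 (fun f : bijection (P * bool) => f (1, true)) (hh' p).
rewrite /= /swap /translate /= mulg1 (asboolT S1) /= addbF => -[].
by move=> /esym/asboolP.
Qed.

End Generation.

Variable h : {multiplicative P -> bijection (seq letter * A)}.
Hypothesis hj : forall b x, h (j b x) = word_action x.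

Let hM x y w : h (x * y) w = h x (h y w).
Proof. by rewrite gmulfM. Qed.

Let h1 w : h 1 w = w.
Proof. by rewrite morph1. Qed.

Let hVK x w : h x (h x^-1 w) = w.
Proof. by rewrite -hM mulgV h1. Qed.

Lemma reduced_action k w : reduced (h k w).1 = reduced w.1.
Proof.
elim/factors_generate: k w => [w|x y Sx Sy w|x Sx w|b x w].
- by rewrite h1.
- by rewrite hM Sx Sy.
- by rewrite -[in RHS](hVK x w) Sx.
by rewrite hj /= /act; case: ifP => // /(gact_reduced x) ->.
Qed.

Lemma dist_action k w w' : reduced w.1 -> reduced w'.1 ->
  dist (h k w).1 (h k w').1 = dist w.1 w'.1.
Proof.
elim/factors_generate: k w w' => [w w'|x y Sx Sy w w'|x Sx w w'|b x w w'].
- by rewrite !h1.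
- by move=> rw rw'; rewrite !hM Sx ?reduced_action ?Sy.
- by move=> rw rw'; rewrite -[in RHS](hVK x w) -[in RHS](hVK x w') Sx ?reduced_action.
by move=> rw rw'; rewrite hj /= /act rw rw' dist_gact.
Qed.

Fixpoint eval_letters (l : seq letter) : P :=
  if l is existT b t :: l' then j b t * eval_letters l' else 1.

Definition eval (w : seq letter * A) : P :=
  eval_letters w.1 * j true (i true w.2).

Lemma eval_push a l : j true (i true a) * eval_letters l =
  eval_letters (push a l).1 * j true (i true (push a l).2).
Proof.
elim: l a => [|[b t] l IH] a /=; first by rewrite mul1g mulg1.
rewrite -mulgA -IH (j_base true b) !mulgA -gmulfM [in LHS](repE (i b a * t)).
by rewrite gmulfM (j_base true b).
Qed.

Lemma eval_cons_rep b (t : G b) l c :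
  eval (cons_rep t l, c) = j b t * eval (l, c).
Proof.
rewrite /eval /cons_rep; case: eqP => [->|_] /=; first by rewrite morph1 mul1g.
by rewrite mulgA.
Qed.

(** Applied to the empty word, this recovers [k] from its normal form. *)
Lemma eval_action k w : reduced w.1 -> eval (h k w) = k * eval w.
Proof.
elim/factors_generate: k w => [w|x y Sx Sy w|x Sx w|b x w] rw.
- by rewrite h1 mul1g.
- by rewrite hM Sx ?reduced_action // Sy // mulgA.
- by rewrite -[in RHS](hVK x w) Sx ?reduced_action // mulKg.
rewrite hj /= /act rw; have [t [l [c [_ bl ->]]]] := reduced_pair b rw.
rewrite gact_cons // !eval_cons_rep [in RHS]mulgA -(@gmulfM _ _ (j b)).
rewrite [in RHS](repE (x * t)) (@gmulfM _ _ (j b)).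
rewrite -mulgA (j_base b true); congr (_ * _).
by rewrite /eval /= !gmulfM !mulgA eval_push.
Qed.

(** Forgetting the component in [A] leaves the coset of [g] modulo [A], an edge of the Bass-Serre
    tree; [dist] measures between midpoints of edges. *)
Definition word g : seq letter := (h g ([::], 1)).1.

Definition word_length g : nat := size (word g).

Lemma word1 : word 1 = [::].
Proof. by rewrite /word h1. Qed.

Lemma word_reduced g : reduced (word g).
Proof. by rewrite reduced_action. Qed.

Lemma wordE g : exists c, g = eval_letters (word g) * j true (i true c).
Proof.
exists (h g ([::], 1)).2.
have e : eval (h g ([::], 1)) = g.
  by rewrite eval_action // /eval /= !morph1 !mulg1.
by rewrite -[LHS]e.
Qed.

Lemma word_factor b (x : G b) : word (j b x) = cons_rep (rep x) [::].
Proof. by rewrite /word hj /= /act /= /gact /= mulg1. Qed.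

(** The image of the empty word under [x] displays both [rep x] and [tail x]. *)
Lemma j_inj b : injective (j b).
Proof.
have ker x : j b x = 1 -> x = 1.
  move=> jx; have := congr1 (fun g => h g ([::], 1)) jx.
  rewrite h1 hj /= /act /= /gact /= !mulg1 /cons_rep.
  by case: eqP => // x1 [] tx; rewrite [x]repE x1 tx mul1g morph1.
move=> x y xy; apply/divg1_eq/ker.
by rewrite gmulfM morphV xy mulgV.
Qed.

Lemma dist_word g k : dist (word g) (word k) = word_length (g^-1 * k).
Proof.
rewrite -(@dist_action g^-1) ?reduced_action // -!hM mulVg h1.
by rewrite dist_nil.
Qed.

Lemma word_length1 : word_length 1 = 0.
Proof. by rewrite /word_length word1. Qed.

Lemma word_lengthV g : word_length g^-1 = word_length g.
Proof.
have := dist_word g 1; rewrite word1 distC dist_nil mulg1 => <-.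
by [].
Qed.

Lemma word_length_four_point p q r s :
  word_length (p^-1 * q) + word_length (r^-1 * s) <=
  maxn (word_length (p^-1 * r) + word_length (q^-1 * s))
       (word_length (p^-1 * s) + word_length (q^-1 * r)).
Proof. by rewrite -!dist_word; apply: dist_four_point. Qed.

Definition factor b (x : P) : Prop := exists g : G b, x = j b g.

Lemma factorM b x y : factor b x -> factor b y -> factor b (x * y).
Proof. by move=> [g ->] [k ->]; exists (g * k); rewrite gmulfM. Qed.

Lemma factorV b x : factor b x -> factor b x^-1.
Proof. by move=> [g ->]; exists g^-1; rewrite morphV. Qed.

Lemma factor_base b a : factor b (j true (i true a)).
Proof. by exists (i b a); apply: j_base. Qed.

Lemma factor_length b x : factor b x -> word_length x <= 1.
Proof.
by move=> [g ->]; rewrite /word_length word_factor /cons_rep; case: ifP.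
Qed.

Lemma short_factor x : word_length x <= 1 -> exists b, factor b x.
Proof.
rewrite /word_length; have [c e] := wordE x.
case: (word x) e => [|[b t] [|//]] /= -> _.
  by exists true; rewrite mul1g; apply: factor_base.
by exists b; rewrite mulg1; apply: factorM (factor_base _ _); exists t.
Qed.

Lemma word_nil_factor b x : word x = [::] -> factor b x.
Proof.
move=> x0; have [c] := wordE x; rewrite x0 mul1g => ->; exact: factor_base.
Qed.

Lemma word_mul_factor b (g s : G b) l x :
  word x = cons_rep s l -> alternating b l ->
  word (j b g * x) = cons_rep (rep (g * s)) (push (tail (g * s)) l).1.
Proof.
move=> ex bl; have rx := word_reduced x.
rewrite /word hM hj /= /act rx.
have -> : h x ([::], 1) = (cons_rep s l, (h x ([::], 1)).2).
  by rewrite -ex; apply: surjective_pairing.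
by rewrite gact_cons.
Qed.

(** Cyclic reduction: if [x] is neither short nor straight, conjugating by its first letter shortens
    it. *)
Lemma straight_or_factor x : exists p,
  (exists b, factor b (x ^ p)) \/ straight word_length (x ^ p).
Proof.
move: {2}(word_length x) (leqnn (word_length x)) => n.
elim: n x => [|n IH] x le_n.
  by exists 1; left; rewrite conjg1; apply: short_factor; lia.
have [le1|gt1] := leqP (word_length x) 1.
  by exists 1; left; rewrite conjg1; apply: short_factor.
have [xx|xx] := eqVneq (word_length (x * x)) (word_length x + word_length x).
  by exists 1; right; rewrite conjg1; split=> //; lia.
case ex : (word x) => [|[b t] l]; first by rewrite /word_length ex in gt1.
have [tt t1] : rep t = t /\ t != 1.
  by have := word_reduced x; rewrite ex => /orP[] /= /and4P[_ /eqP -> ->].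
pose T := j b t; have eT : word T = [:: existT G b t].
  by rewrite word_factor tt /cons_rep (negPf t1).
(* The loss of length in [x * x] forces the words of [x^-1] and [x] to start in the same factor. *)
have eV : 0 < overlap (word x^-1) (word T).
  have := dist_word x^-1 x; rewrite invgK /dist => d.
  have : 0 < overlap (word x^-1) (word x).
    move: xx; rewrite -d -[size (word x)]/(word_length x).
    rewrite -[size (word x^-1)]/(word_length x^-1) word_lengthV.
    by case: overlap => //; rewrite subn0 eqxx.
  rewrite eT ex; case: (word x^-1) => [//|v m] /=.
  by case: ifP => // _; case: ifP.
have dT : word_length (T^-1 * x^-1) <= word_length x.
  rewrite -dist_word distC /dist -/(word_length x^-1) word_lengthV.
  by rewrite eT in eV *; rewrite /=; lia.
have dTx : (word_length (T^-1 * x)).+1 = word_length x.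
  rewrite -dist_word /word_length ex eT /dist /= !eqxx /=; lia.
have lT : word_length T = 1%N by rewrite /word_length eT.
have [p Hp] : exists p, (exists b, factor b ((x ^ T) ^ p)) \/
    straight word_length ((x ^ T) ^ p).
  apply: IH.
  (* The sum [|x ^ T| + |x|] is at most the maximum of 2 and [2 * |x| - 1]; as [|x|] exceeds 1,
     [x ^ T] is shorter than [x]. *)
  have := word_length_four_point T (x * T) 1 x.
  rewrite invg1 mul1g mulg1 word_lengthV lT.
  have -> : word_length ((x * T)^-1 * x) = 1%N.
    by rewrite invgM -mulgA mulVg mulg1 word_lengthV.
  have -> : word_length ((x * T)^-1 * 1) = word_length (T^-1 * x^-1).
    by rewrite mulg1 invgM.
  rewrite -/(conjg x T); move: dT dTx le_n gt1.
  move: (word_length (T^-1 * x^-1)) (word_length (T^-1 * x)) => u v.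
  move: (word_length x) (word_length (x ^ T)) => nx nT; lia.
by exists (T * p); rewrite conjgM.
Qed.

Hypothesis i_malnormal : forall b a (s : G b),
  a <> 1 -> base (i b a ^ s) -> base s.

Lemma factorI b b' x : b != b' -> factor b x -> factor b' x -> word_length x = 0.
Proof.
move=> bb' [g xg] [k xk]; rewrite /word_length; have := word_factor g.
rewrite -xg xk word_factor /cons_rep; case: eqP => _; first by [].
by case: eqP => // _ [/eqP]; rewrite eq_sym (negPf bb').
Qed.

(** Write [g = t y] with [t] in factor [b] and the word [l] of [y] not starting there, so that
    [x ^ g = k ^ y] with [k = x ^ t]. The length of [x ^ g] is the distance from [k y] to [y]. For
    nonempty [l] it exceeds 1 if [k] is outside [A]. If [k] is in [A], it moves the first letter of
    [l], so length at most 1 leaves [l] a single letter; then [x ^ g] lies in both factors and has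
    length 0, although the distance is 1. *)
Lemma factor_malnormal b x g :
  factor b x -> x <> 1 -> factor b (x ^ g) -> factor b g.
Proof.
move=> Vx x1 Vxg.
have [t [l [_ bl eg]]] := reduced_split b (word_reduced g).
pose y := (j b t)^-1 * g; have gE : g = j b t * y by rewrite mulVKg.
have ey : word y = l.
  rewrite /y -morphV (word_mul_factor _ eg bl) mulVg rep1 tail1 (push1 bl).
  by rewrite /cons_rep eqxx.
have [l0|l0] := eqVneq l [::].
  rewrite gE; apply: factorM; first by exists t.
  by apply: word_nil_factor; rewrite ey.
have [k k1 eky] : exists2 k : G b, k <> 1 & x ^ g = j b k ^ y.
  have [x' xE] := Vx.
  have e : j b (x' ^ t) = x ^ j b t by rewrite xE morphJ.
  exists (x' ^ t); last by rewrite e gE conjgM.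
  move=> k1; move: e; rewrite k1 morph1 => /esym/eqP.
  by rewrite conjg_eq1 => /eqP.
have dky : dist (word (j b k * y)) (word y) = word_length (x ^ g).
  rewrite dist_word eky -(word_lengthV (_ ^ y)) /conjg; congr word_length.
  by rewrite [RHS]invgM invgK.
have le1 := factor_length Vxg.
have ey1 : word y = @cons_rep b 1 l by rewrite /cons_rep eqxx.
move: dky; rewrite (word_mul_factor k ey1 bl) mulg1 ey1 dist_cons_rep
  ?push_alternating //.
case: eqP => [/rep_eq1[a ka]|_] dl; last first.
  by move: le1 l0; rewrite -dl size_push; case: (l).
have a1 : a <> 1 by move=> a1; apply: k1; rewrite ka a1 morph1.
rewrite ka tail_base in dl.
case: l l0 bl ey dl {eg ey1} => [//|[b' s] m] _ /= /and4P[bb' /eqP ss /eqP s1 mm] ey.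
(* If [a] fixed the coset of [s], then [a ^ s] would lie in [A], and malnormality would put [s] in
   [A]. *)
have sa : rep (i b' a * s) != s.
  apply/eqP => as_s; apply: s1; rewrite -ss; apply: base_rep.
  apply: (i_malnormal a1); exists (tail (i b' a * s)).
  by rewrite /conjg {1}[i b' a * s]repE as_s mulKg.
rewrite /dist /= eqxx /= eq_letter (negPf sa) size_push => dl.
rewrite -dl in le1.
have m0 : m = [::] by case: (m) le1 => //= ? ?; lia.
subst m; have Vy : factor b' y.
  have [c] := wordE y; rewrite ey /= mulg1 => ->.
  by apply: factorM; [exists s | apply: factor_base].
have Vk : factor b' (j b k) by exists (i b' a); rewrite ka; apply: j_base.
have Vxg' : factor b' (x ^ g).
  by rewrite eky; apply: factorM; [apply: factorV | apply: factorM].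
by have := factorI bb' Vxg' Vxg; rewrite -dl.
Qed.

End Pushout.

End Amalgam.

(** * CSA groups and the theorem *)

Lemma exists_noncommuting (G : groupType) (x : G) :
  commutation_transitive G -> ~ abelian_group G -> x <> 1 ->
  exists y, ~ commute x y.
Proof.
move=> ct nab x1; apply: contrapT => nex; apply: nab => y z.
have cx t : commute x t by apply: contrapT => xt; apply: nex; exists t.
by apply: (ct y x z x1) => //; apply: commute_sym.
Qed.

(** For an involution [x] and [y = x ^ t], conjugation by [x] inverts [x * y], so rigidity makes [x]
    commute with [x * y], hence with [y], and by rigidity again with [t]. But [t] can be chosen not
    to commute with [x]. *)
Lemma no_involution (G : groupType) (x : G) :
  commutation_transitive G -> conjugation_rigid G -> ~ abelian_group G ->
  x * x = 1 -> x = 1.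
Proof.
move=> ct rigid nab xx; apply: contrapT => x1.
have xV : x^-1 = x by apply: mulg1_eq.
have [t] := exists_noncommuting ct nab x1; apply.
apply: (rigid x t x1); set y := x ^ t.
have yV : y^-1 = y by rewrite /y -conjVg xV.
have [xy1|xy1] := pselect (x * y = 1).
  by rewrite -(mulg1_eq xy1) xV.
have xyx : (x * y) ^ x = (x * y)^-1.
  by rewrite /conjg -mulgA mulKg invgM xV yV.
have : commute (x * y) x.
  by apply: (rigid _ _ xy1); rewrite xyx; apply: commuteV.
rewrite /commute -mulgA => /mulgI <- //.
Qed.

Section CSA.

Variable G : groupType.

Lemma exists_maximal_abelian (x y : G) : commute x y ->
  exists M : set G, [/\ maximal_abelian M, M x & M y].
Proof.
move=> xy.
(* Members of [F] centralize [x] and [y] instead of containing them, so that the union of the empty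
   chain qualifies; maximality ([sat]) supplies [x], [y] and the subgroup laws. *)
pose F : set (set G) := fun M => (forall u v, M u -> M v -> commute u v) /\
  (forall u, M u -> commute u x /\ commute u y).
have [|M [[Mc Mxy] Mmax]] := @Zorn_bigcup G F.
  move=> C CF Ctot; split=> [u v [U CU Uu] [W CW Wv]|u [U CU Uu]].
    have [UW|WU] := Ctot _ _ CU CW.
      by have [H _] := CF _ CW; apply: H => //; apply: UW.
    by have [H _] := CF _ CU; apply: H => //; apply: WU.
  by have [_ H] := CF _ CU; apply: H.
have sat z : (forall u, M u -> commute u z) -> commute x z -> commute y z -> M z.
  move=> Mz xz yz; apply: contrapT => nMz.
  apply: (Mmax [set u | M u \/ u = z]%classic).
    split; last by move=> /(_ z) H; apply/nMz/H; right.
    by move=> u Mu; left.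
  split=> [u v [Mu|->] [Mv|->]|u [Mu|->]] //.
  - exact: Mc.
  - exact: Mz.
  - by apply/commute_sym/Mz.
  - exact: Mxy.
have Mx : M x by apply: sat => // u /Mxy[].
have My : M y by apply: sat => // u /Mxy[].
exists M; split=> //; split.
  split=> //; split=> [|u v]; rewrite !inE.
    by apply: sat => *; apply: commute1.
  move=> /= Mu Mv; apply: sat => [w Mw||];
    by apply: commuteM; [|apply: commuteV]; apply: Mc.
move=> N [_ Nc] MN; apply/seteqP; split=> // z Nz.
by apply: sat => [u Mu||]; apply: Nc => //; apply: MN.
Qed.

Hypothesis G_CSA : CSA G.

Lemma CSA_normalizer (M : set G) x g : maximal_abelian M ->
  M x -> M (x ^ g) -> x <> 1 -> M g.
Proof.
move=> /G_CSA[_ mal] Mx Mxg x1; apply: mal => /seteqP[sub _].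
have /sub /= : ([set u ^ g | u in M] `&` M)%classic (x ^ g).
  by split=> //; exists x.
by move/eqP; rewrite conjg_eq1 => /eqP.
Qed.

(** Malnormality of a maximal abelian [M] containing [x] and [y] is applied to [y ^ z = y]. *)
Lemma CSA_commutation_transitive : commutation_transitive G.
Proof.
move=> x y z y1 xy yz; have [M [Mmax Mx My]] := exists_maximal_abelian xy.
have Mz : M z by apply: (CSA_normalizer Mmax My) => //; rewrite conjg_fixE.
by case: Mmax => -[_ Mc] _; apply: Mc.
Qed.

Lemma CSA_conjugation_rigid : conjugation_rigid G.
Proof.
move=> x g x1 xxg; have [M [Mmax Mx Mxg]] := exists_maximal_abelian xxg.
have Mg := CSA_normalizer Mmax Mx Mxg x1.
by case: Mmax => -[_ Mc] _; apply: Mc.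
Qed.

End CSA.

Lemma malnormal_range (A G : groupType) (f : {multiplicative A -> G}) a s b :
  injective f -> malnormal (range f) -> a <> 1 -> f a ^ s = f b ->
  exists c, s = f c.
Proof.
move=> f_inj [_ mal] a1 fas; suff [c _ fc] : range f s by exists c.
apply: mal => /seteqP[sub _].
have /sub /= fb1 : ([set u ^ s | u in range f] `&` range f)%classic (f b).
  by split; [exists (f a) => //; exists a | exists b].
by apply/a1/f_inj; rewrite morph1; apply/eqP; rewrite -(conjg_eq1 _ s) fas fb1.
Qed.

Section Amalgams.

Variables (A : groupType) (G : bool -> groupType) (P : groupType).
Variables (i : forall b, {multiplicative A -> G b}).
Variables (j : forall b, {multiplicative G b -> P}).
Hypothesis i_inj : forall b, injective (i b).
Hypothesis i_mal : forall b, malnormal (range (i b)).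
Hypothesis j_base : forall b b' a, j b (i b a) = j b' (i b' a).
Hypothesis j_univ : forall (H : groupType) (f : forall b, {multiplicative G b -> H}),
  (forall b b' a, f b (i b a) = f b' (i b' a)) ->
  exists h : {multiplicative P -> H}, forall b x, h (j b x) = f b x.
Hypothesis j_epi : forall (H : groupType) (h h' : {multiplicative P -> H}),
  (forall b x, h (j b x) = h' (j b x)) -> h =1 h'.
Hypothesis G_nonabelian : forall b, ~ abelian_group (G b).
Hypothesis G_CSA : forall b, CSA (G b).

Lemma amalgam_transitive_rigid :
  commutation_transitive P /\ conjugation_rigid P.
Proof.
have [h hj] := @j_univ _ (fun b => @word_action A G i i_inj b : {multiplicative _ -> _})
  (fun b b' a => word_action_base i_inj a b b').
have ct b := CSA_commutation_transitive (@G_CSA b).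
have rigid b := CSA_conjugation_rigid (@G_CSA b).
have inj b : injective (j b) := @j_inj _ _ _ _ _ _ _ hj b.
have j1 b (x : G b) : j b x <> 1 -> x <> 1.
  by move=> jx x1; apply: jx; rewrite x1 morph1.
have jcomm b (x y : G b) : commute (j b x) (j b y) -> commute x y.
  by move=> xy; apply: inj; rewrite !gmulfM.
have mal b a (s : G b) : a <> 1 -> base i (i b a ^ s) -> base i s.
  by move=> a1 [c /(malnormal_range (@i_inj b) (@i_mal b) a1)[d ->]]; exists d.
have short x : word_length h x = 0 -> exists b, factor j b x.
  by move=> x0; apply: (short_factor j_base j_epi hj); rewrite x0.
split.
  apply: (@criterion_transitive P (word_length h) (word_length1 h)
    (word_lengthV j_epi hj) (word_length_four_point j_epi hj) bool (factor j)
    (@factorM _ _ _) (@factor_malnormal _ _ _ _ _ _ j_base j_epi _ hj mal)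
    _ (@factor_length _ _ _ _ _ _ _ hj) short
    (straight_or_factor j_base j_epi hj)).
  move=> b _ _ _ [x ->] [y ->] [z ->] /j1 y1 /jcomm xy /jcomm yz.
  by apply: gmulf_commute; apply: ct xy yz.
apply: (@criterion_rigid P (word_length h) (word_length1 h)
  (word_lengthV j_epi hj) (word_length_four_point j_epi hj) bool (factor j)
  (@factorM _ _ _) (@factor_malnormal _ _ _ _ _ _ j_base j_epi _ hj mal)
  _ _ (@factor_length _ _ _ _ _ _ _ hj) short
  (straight_or_factor j_base j_epi hj)).
- move=> b _ _ [x ->] [g ->] /j1 x1; rewrite -morphJ => /jcomm xxg.
  by apply: gmulf_commute; apply: rigid.
- move=> b _ [x ->]; rewrite -gmulfM -[X in _ = X -> _](morph1 (j b)) => /inj xx.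
  by rewrite (no_involution (@ct b) (@rigid b) (@G_nonabelian b) xx) morph1.
Qed.

End Amalgams.

Lemma malnormal_amalgam_transitive_rigid (X : group_class) (P : groupType) :
  (forall G : groupType, X G -> ~ abelian_group G /\ CSA G) ->
  malnormal_amalgams X P ->
  commutation_transitive P /\ conjugation_rigid P.
Proof.
move=> hX [G1 [G2 [A [i1 [i2 [j1 [j2 [X1 X2 mal1 mal2 [inj1 inj2 ji univ]]]]]]]]].
pose G b := if b then G1 else G2.
pose i b := if b return {multiplicative A -> G b} then i1 else i2.
pose j b := if b return {multiplicative G b -> P} then j1 else j2.
apply: (@amalgam_transitive_rigid A G P i j).
- by case.
- by case.
- by case=> -[].
- move=> H f fi; have [|h [h1 h2 _]] := univ H (f true) (f false).
    by move=> a; apply: (fi true false).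
  by exists h => -[].
- move=> H h h' hh'.
  have [|k [_ _ uniq]] := univ H (h \o j1) (h \o j2).
    by move=> a /=; rewrite ji.
  move=> x; rewrite (uniq h) // (uniq h') // => y.
    by rewrite -(hh' true).
  by rewrite -(hh' false).
- by case; [case: (hX _ X1)|case: (hX _ X2)].
- by case; [case: (hX _ X1)|case: (hX _ X2)].
Qed.

(** * Residual and fully residual properties *)

Section ResidualProperties.

Variables (Y : group_class) (G : groupType).
Hypothesis Y_transitive : forall H, Y H -> commutation_transitive H.
Hypothesis Y_rigid : forall H, Y H -> conjugation_rigid H.

Lemma fully_residually_residually : fully_residually Y G -> residually Y G.
Proof.
move=> full g g1; have [|H YH [phi Hphi]] := full [:: g].
  by move=> _ /[!inE] /eqP ->.
by exists H => //; exists phi; apply: Hphi; rewrite inE.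
Qed.

(** A homomorphism keeping [y] and [[~ x, z]] nontrivial would contradict transitivity in its
    target. *)
Lemma fully_residually_transitive :
  fully_residually Y G -> commutative_transitive G.
Proof.
move=> full x y z x1 y1 z1 xy yz; apply: contrapT => xz1.
have [|H YH [phi Hphi]] := full [:: y; [~ x, z]].
  by move=> g /[!inE] /orP[] /eqP ->.
have phi_y : phi y <> 1 by apply: Hphi; rewrite inE eqxx.
have phi_xz : phi [~ x, z] <> 1 by apply: Hphi; rewrite !inE eqxx orbT.
apply: phi_xz; rewrite morphR; apply/eqP/commgP.
apply: (Y_transitive YH phi_y); apply: gmulf_commute.
  by apply/commgP/eqP.
by apply/commgP/eqP.
Qed.

Hypothesis G_nonabelian : ~ abelian_group G.
Hypothesis G_residual : residually Y G.
Hypothesis G_transitive : commutative_transitive G.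

Let ctG : commutation_transitive G.
Proof.
move=> x y z y1 xy yz.
have [->|x1] := pselect (x = 1); first exact/commute_sym/commute1.
have [->|z1] := pselect (z = 1); first exact: commute1.
by apply/commgP/eqP; apply: (G_transitive x1 y1 z1); apply/eqP/commgP.
Qed.

(* Otherwise all conjugates of [g] commute with [g]; a homomorphism that does
   not kill some commutator [~ g, t] would contradict rigidity. *)
Lemma exists_noncommuting_conjugate (f g : G) :
  f <> 1 -> g <> 1 -> exists t, [~ f, g ^ t] <> 1.
Proof.
move=> f1 g1; apply: contrapT => nex.
have fg t : commute f (g ^ t).
  by apply/commgP/eqP; apply: contrapT => fgt; apply: nex; exists t.
have gg t : commute g (g ^ t).
  apply: (ctG f1 _ (fg t)); apply: commute_sym.
  by rewrite -[g]conjg1; apply: fg.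
have [t gt] := exists_noncommuting ctG G_nonabelian g1.
have [|H YH [phi]] := G_residual (g := [~ g, t]).
  by move=> gt1; apply: gt; apply/commgP/eqP.
apply; rewrite morphR; apply/eqP/commgP.
have [->|pg1] := pselect (phi g = 1); first exact/commute_sym/commute1.
by apply: (Y_rigid YH pg1); rewrite -morphJ; apply: gmulf_commute.
Qed.

(** The list is folded into one nontrivial iterated commutator [[~ g, w ^ t]], which dies in any
    quotient that kills [g] or [w]. *)
Lemma residually_fully_residually : fully_residually Y G.
Proof.
move=> s s1.
have [w w1 Hw] : exists2 w : G, w <> 1 &
    forall (H : groupType) (phi : {multiplicative G -> H}), phi w <> 1 ->
      forall g, g \in s -> phi g <> 1.
  elim: s s1 => [_|g s IH s1].
    have [x x1] : exists x : G, x <> 1.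
      apply: contrapT => nex; apply: G_nonabelian => x y.
      have -> : x = 1 by apply: contrapT => x1; apply: nex; exists x.
      exact/commute_sym/commute1.
    by exists x.
  have [|w w1 Hw] := IH; first by move=> f fs; apply: s1; rewrite inE fs orbT.
  have g1 : g <> 1 by apply: s1; rewrite inE eqxx.
  have [t gwt] := exists_noncommuting_conjugate g1 w1.
  exists [~ g, w ^ t] => // H phi; rewrite morphR morphJ => pgw f.
  rewrite inE => /orP[/eqP ->|fs]; first by move=> pg; rewrite pg comm1g in pgw.
  apply: Hw fs => pw; apply: pgw; rewrite pw conj1g; exact: commg1.
have [H YH [phi pw]] := G_residual w1.
by exists H => //; exists phi; apply: Hw.
Qed.

End ResidualProperties.

Theorem corollary4p3 (X : group_class)
    (hX : forall G : groupType, X G -> ~ abelian_group G /\ CSA G) :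
  satisfies_B (malnormal_amalgams X).
Proof.
have ct H (YH : malnormal_amalgams X H) : commutation_transitive H.
  by have [] := malnormal_amalgam_transitive_rigid hX YH.
have rigid H (YH : malnormal_amalgams X H) : conjugation_rigid H.
  by have [] := malnormal_amalgam_transitive_rigid hX YH.
move=> G nab; split=> [full|[res trans]].
  split; first exact: fully_residually_residually.
  exact: fully_residually_transitive full.
exact: residually_fully_residually.
Qed.
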